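(* Let $\mathfrak g$ be a finite-dimensional Lie algebra over $\mathbb K\in\{\mathbb R,\mathbb C\}$ with $H^i(\mathfrak g,S^2(\mathfrak g))=0$ for $i=1,2$, and let $\pi_1$ be the Lie–Poisson bivector on $\mathfrak g^*$. Then: (1) each quadratic Poisson bivector on $\mathfrak g^*$ compatible with $\pi_1$ is of the form $[X,\pi_1]$ for some quadratic vector field $X$ on $\mathfrak g^*$; (2) the quadratic vector field $X$ in (1) is determined up to the addition of a quadratic vector field $Z$ with $[Z,\pi_1]=0$, and every such $Z$ is a hamiltonian vector field, $Z=\pi_1(f)$ for some quadratic polynomial $f$ on $\mathfrak g^*$.
   Context: $H^\bullet(\mathfrak g,S^2(\mathfrak g))$ is Chevalley–Eilenberg cohomology with coefficients in the symmetric square of the adjoint module. A multivector field on a vector space is called linear, quadratic, cubic, etc. if its coefficients in linear coordinates are homogeneous polynomials of degree $1,2,3,\dots$; likewise a quadratic polynomial is homogeneous of degree 2. $[\cdot,\cdot]$ is the Schouten bracket of multivector fields, normalized by $[X,f]=Xf$ for a vector field $X$ and a function $f$, $[X,Y]$ the Lie bracket for vector fields, $[P,Q]=-(-1)^{(p-1)(q-1)}[Q,P]$ and $[P,Q\wedge R]=[P,Q]\wedge R+(-1)^{(p-1)q}Q\wedge[P,R]$ for $P,Q$ of degrees $p,q$; in particular $[X,\eta]=\mathcal L_X\eta$. For a bivector $\eta$ and a function $f$ put $\eta(f):=[\eta,f]$ (a vector field). A bivector $\eta$ is Poisson if $[\eta,\eta]=0$; Poisson bivectors $\eta_1,\eta_2$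 are compatible if $[\eta_1,\eta_2]=0$. The Lie–Poisson bivector $\pi_1$ on $\mathfrak g^*$ is the one whose bracket satisfies $\{x,y\}_{\pi_1}=[x,y]$ for $x,y\in\mathfrak g$ regarded as linear functions on $\mathfrak g^*$. *)

(* Defs.v *)
From mathcomp Require Export all_boot all_algebra.
From mathcomp Require Export complex mpoly reals.

Set Implicit Arguments.
Unset Strict Implicit.
Unset Printing Implicit Defensive.

Import GRing.Theory.
Local Open Scope ring_scope.

Section LieCohomology.

Variables (K : fieldType) (g : vectType K).
Implicit Types (br : g -> g -> g) (x y z : g).

Record lie_bracket br : Prop := LieBracket {
  lie_linear_l : forall a x y z, br (a *: x + y) z = a *: br x z + br y z;
  lie_linear_r : forall a x y z, br z (a *: x + y) = a *: br z x + br z y;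
  lie_alt : forall x, br x x = 0;
  lie_jacobi : forall x y z, br x (br y z) + br y (br z x) + br z (br x y) = 0
}.

Variables (M : lmodType K) (br : g -> g -> g) (act : g -> M -> M).
Implicit Types (w t : seq g -> M) (s : seq g).

(* A k-cochain is an alternating k-linear map g^k -> M; it is encoded as a    *)
(* function on lists of which only the values on lists of length k matter.    *)
Record cochain (k : nat) w : Prop := Cochain {
  cochain_linear : forall s1 s2 a x y, (size s1 + size s2).+1 = k ->
    w (s1 ++ (a *: x + y) :: s2) = a *: w (s1 ++ x :: s2) + w (s1 ++ y :: s2);
  cochain_alt : forall s1 s2 s3 x, (size s1 + size s2 + size s3).+2 = k ->
    w (s1 ++ x :: s2 ++ x :: s3) = 0
}.

Definition delete (i : nat) s : seq g := take i s ++ drop i.+1 s.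

(* Chevalley-Eilenberg differential:                                          *)
(*   (dw)(x_0,...,x_k) = sum_i (-1)^i x_i . w(.. ^x_i ..)                     *)
(*     + sum_(i < j) (-1)^(i + j) w([x_i, x_j], .. ^x_i .. ^x_j ..).          *)
Definition ce_diff w s : M :=
  \sum_(i < size s) (-1) ^+ i *: act s`_i (w (delete i s))
  + \sum_(j < size s) \sum_(i < j)
      (-1) ^+ (i + j) *: w (br s`_i s`_j :: delete i (delete j s)).

Definition cocycle (k : nat) w : Prop :=
  cochain k w /\ forall s, size s = k.+1 -> ce_diff w s = 0.

Definition coboundary (k : nat) w : Prop :=
  if k is l.+1
  then exists2 t, cochain l t & forall s, size s = k -> w s = ce_diff t s
  else w [::] = 0.

Definition cohomology_vanishes (k : nat) : Prop :=
  forall w, cocycle k w -> coboundary k w.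

End LieCohomology.

Section Multivectors.

Variables (K : fieldType) (n : nat).

(* Polynomial multivector fields on a space with linear coordinates X_0, ..,  *)
(* X_(n-1): P stands for the sum over A = {i_1 < ... < i_p} of                *)
(* P A * d/dX_(i_1) /\ ... /\ d/dX_(i_p).                                     *)
Definition multivector := {ffun {set 'I_n} -> {mpoly K[n]}}.

Implicit Types (A B C : {set 'I_n}) (P Q : multivector) (f h : {mpoly K[n]}).

Definition has_degree (p : nat) P : Prop := forall A, #|A| != p -> P A = 0.

Definition homogeneous (d : nat) P : Prop := forall A, P A \is d.-homog.

Definition mvfun f : multivector := [ffun A : {set 'I_n} => if A == set0 then f else 0].

(* For disjoint A and B, d_A /\ d_B = sgn A B * d_(A :|: B), by sorting. *)
Definition sgn A B : {mpoly K[n]} :=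
  (-1) ^+ #|[set u : 'I_n * 'I_n | [&& u.1 \in A, u.2 \in B & (u.2 < u.1)%N]]|.

Definition wedge P Q : multivector :=
  [ffun C : {set 'I_n} => \sum_(A : {set 'I_n} | A \subset C)
               sgn A (C :\: A) * P A * Q (C :\: A)].

Definition pderiv (i : 'I_n) P : multivector := [ffun A : {set 'I_n} => (P A)^`M(i)].

(* Left and right derivatives in the odd variable d_i := d/dX_i: they send    *)
(* d_i /\ d_B, respectively d_B /\ d_i, to d_B when i is not in B, and        *)
(* kill d_A when i is not in A.                                               *)
Definition lodd (i : 'I_n) P : multivector :=
  [ffun B : {set 'I_n} => if i \in B then 0 else sgn [set i] B * P (i |: B)].
Definition rodd (i : 'I_n) P : multivector :=
  [ffun B : {set 'I_n} => if i \in B then 0 else sgn B [set i] * P (i |: B)].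

(* The Schouten bracket in coordinates, as an odd Poisson bracket. For P and  *)
(* Q of degrees p and q the second term is the first one with P and Q         *)
(* exchanged, times -(-1)^((p-1)(q-1)).                                       *)
Definition schouten P Q : multivector :=
  \sum_(i < n) (wedge (rodd i P) (pderiv i Q) - wedge (pderiv i P) (lodd i Q)).

Definition vector_field P : Prop := has_degree 1 P.
Definition bivector P : Prop := has_degree 2 P.
Definition quadratic P : Prop := homogeneous 2 P.

Definition poisson P : Prop := bivector P /\ schouten P P = 0.
Definition compatible P Q : Prop := schouten P Q = 0.

Definition hamiltonian P f : multivector := schouten P (mvfun f).

(* {f, h} = P(df, dh) for a bivector P; this is - [[P, f], h]. *)
Definition poisson_bracket P f h : {mpoly K[n]} :=
  \sum_(i < n) \sum_(j < n | (i < j)%N)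
     P [set i; j] * (f^`M(i) * h^`M(j) - f^`M(j) * h^`M(i)).

Let sgn0 A : sgn A set0 = 1 /\ sgn set0 A = 1.
Proof.
by split; rewrite /sgn (_ : [set u | _] = set0) ?cards0 //;
  apply/setP => u; rewrite !inE /= ?andbF.
Qed.

Let wedge_mvfun_l f Q C : wedge (mvfun f) Q C = f * Q C.
Proof.
rewrite ffunE (bigD1 set0) ?sub0set //= setD0 ffunE eqxx (sgn0 _).2 mul1r.
rewrite big1 ?addr0 // => A /andP[_ /negPf A0].
by rewrite ffunE A0 mulr0 mul0r.
Qed.

Let wedge_mvfun_r P f C : wedge P (mvfun f) C = P C * f.
Proof.
rewrite ffunE (bigD1 C) //= setDv ffunE eqxx (sgn0 _).1 mul1r.
rewrite big1 ?addr0 // => A /andP[AC nAC].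
by rewrite ffunE setD_eq0 -[C \subset A](andb_idl (fun _ => AC)) -eqEsubset
           (negPf nAC) mulr0.
Qed.

Let odd_vector_field i P : vector_field P ->
  rodd i P = mvfun (P [set i]) /\ lodd i P = mvfun (P [set i]).
Proof.
move=> vP; split; apply/ffunP => B; rewrite !ffunE.
all: have [-> | /set0Pn[j jB]] := eqVneq B set0.
all: rewrite ?inE ?setU0 ?(sgn0 _).1 ?(sgn0 _).2 ?mul1r //.
all: case: ifPn => // iB; rewrite vP ?mulr0 // cardsU1 iB eqSS.
all: by rewrite cards_eq0; apply/set0Pn; exists j.
Qed.

Lemma schouten_vector_field_fun P f : vector_field P ->
  schouten P (mvfun f) = mvfun (\sum_(i < n) P [set i] * f^`M(i)).
Proof.
move=> vP; apply/ffunP => C; rewrite sum_ffunE [RHS]ffunE.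
have -> : (if C == set0 then \sum_(i < n) P [set i] * f^`M(i) else 0) =
          \sum_(i < n) P [set i] * (if C == set0 then f^`M(i) else 0).
  by case: ifP => // _; rewrite big1 // => i _; rewrite mulr0.
apply: eq_bigr => i _; rewrite (odd_vector_field i vP).1.
have E (S T : multivector) : (S - T) C = S C - T C by rewrite !ffunE.
rewrite E wedge_mvfun_l !ffunE (fun_if (mderiv i)) mderiv0.
rewrite [X in _ - X]big1 ?subr0 // => A _; rewrite !ffunE.
case: ifP => _; first by rewrite mulr0.
rewrite (_ : i |: _ == set0 = false) ?mulr0 //.
by apply/negbTE/set0Pn; exists i; rewrite setU11.
Qed.

Lemma schouten_vector_fields P Q k : vector_field P -> vector_field Q ->
  schouten P Q [set k] =
    \sum_(i < n) (P [set i] * (Q [set k])^`M(i) - Q [set i] * (P [set k])^`M(i)).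
Proof.
move=> vP vQ; rewrite sum_ffunE; apply: eq_bigr => i _.
rewrite (odd_vector_field i vP).1 (odd_vector_field i vQ).2.
have E (S T : multivector) C : (S - T) C = S C - T C by rewrite !ffunE.
by rewrite E wedge_mvfun_l wedge_mvfun_r !ffunE [_ * Q [set i]]mulrC.
Qed.

End Multivectors.

Section LiePoisson.

Variables (K : fieldType) (n : nat) (g : vectType K) (br : g -> g -> g).
(* A basis e of g is a system of linear coordinates on the dual of g; in these *)
(* coordinates, linfct x is x seen as a linear function on the dual.          *)
Variable e : n.-tuple g.

Definition linfct (x : g) : {mpoly K[n]} := \sum_(i < n) coord e i x *: 'X_i.

Definition lie_poisson : multivector K n :=
  [ffun A : {set 'I_n} => \sum_(i < n) \sum_(j < n | (i < j)%N)
     if A == [set i; j] then linfct (br e`_i e`_j) else 0].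

(* The adjoint action of g on its symmetric algebra, realized as the          *)
(* polynomials in the basis e: the derivation extending y |-> [x, y].         *)
Definition sym_act (x : g) (p : {mpoly K[n]}) : {mpoly K[n]} :=
  \sum_(i < n) linfct (br x e`_i) * p^`M(i).

Lemma linfct_homog x : linfct x \is 1.-homog.
Proof.
by apply: rpred_sum => i _; apply: rpredZ; rewrite dhomogX /= mdeg1.
Qed.

Lemma mderiv_homog d (i : 'I_n) (p : {mpoly K[n]}) :
  p \is d.+1.-homog -> p^`M(i) \is d.-homog.
Proof.
move=> hp; apply/dhomogP => m; rewrite mcoeff_msupp mcoeff_deriv => nz.
have : p@_(m + U_(i)) != 0 by apply: contraNneq nz => ->; rewrite mul0rn.
rewrite -mcoeff_msupp => /(dhomog_mf hp) /=.
by rewrite mdegD mdeg1 addn1 => -[].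
Qed.

Lemma sym_act_homog x p : p \is 2.-homog -> sym_act x p \is 2.-homog.
Proof.
move=> hp; apply: rpred_sum => i _.
by apply: (@dhomogM _ _ _ 1%N _ 1%N); [exact: linfct_homog | exact: mderiv_homog].
Qed.

(* S^2(g), as the degree 2 part of the symmetric algebra *)
Definition sym2 := dhomog n K 2.

Definition sym2_act (x : g) (p : sym2) : sym2 :=
  DHomog (sym_act_homog x (dhomog_is_dhomog p)).

Hypotheses (br_lie : lie_bracket br) (e_basis : basis_of fullv e).

Let br_suml x (a : 'I_n -> K) (F : 'I_n -> g) :
  br (\sum_i a i *: F i) x = \sum_i a i *: br (F i) x.
Proof.
have br0 : br 0 x = 0.
  by have := lie_linear_l br_lie (-1) 0 0 x; rewrite !scaler0 addr0 scaleN1r addNr.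
elim/big_rec2: _ => // i y1 y2 _ <-; exact: lie_linear_l.
Qed.

Let br_sumr x (a : 'I_n -> K) (F : 'I_n -> g) :
  br x (\sum_i a i *: F i) = \sum_i a i *: br x (F i).
Proof.
have br0 : br x 0 = 0.
  by have := lie_linear_r br_lie (-1) 0 0 x; rewrite !scaler0 addr0 scaleN1r addNr.
elim/big_rec2: _ => // i y1 y2 _ <-; exact: lie_linear_r.
Qed.

Let linfct_sum (a : 'I_n -> K) (F : 'I_n -> g) :
  linfct (\sum_i a i *: F i) = \sum_i a i *: linfct (F i).
Proof.
rewrite /linfct (eq_bigr (fun k => \sum_i a i *: (coord e k (F i) *: 'X_k))).
  by rewrite exchange_big; apply: eq_bigr => i _; rewrite scaler_sumr.
move=> k _; rewrite linear_sum scaler_suml; apply: eq_bigr => i _.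
by rewrite linearZ /= scalerA.
Qed.

Let mderiv_linfct x (i : 'I_n) : (linfct x)^`M(i) = (coord e i x)%:MP.
Proof.
rewrite /linfct raddf_sum (bigD1 i) //= big1 => [|j ji]; last first.
  by rewrite mderivZ mderivX mnm1E (negPf ji) scale0r scaler0.
rewrite mderivZ; have -> : ('X_i : {mpoly K[n]})^`M(i) = 1.
  rewrite mderivX mnm1E eqxx scale1r -mpolyX0; congr 'X_[_].
  by apply/mnmP => j; rewrite mnmBE subnn mnm0E.
by rewrite -mul_mpolyC mulr1 addr0.
Qed.

Let sum_coord x : x = \sum_(i < n) coord e i x *: e`_i.
Proof. exact: coord_basis e_basis (memvf x). Qed.

Lemma sym_act_linfct x y : sym_act x (linfct y) = linfct (br x y).
Proof.
rewrite [y in RHS]sum_coord br_sumr linfct_sum; apply: eq_bigr => i _.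
by rewrite mderiv_linfct mulrC mul_mpolyC.
Qed.

Lemma sym_actM x p q : sym_act x (p * q) = sym_act x p * q + p * sym_act x q.
Proof.
rewrite /sym_act mulr_suml mulr_sumr -big_split /=; apply: eq_bigr => i _.
by rewrite mderivM mulrDr !mulrA [p * _]mulrC.
Qed.

Let lie_poisson_coef (i j : 'I_n) :
  (i < j)%N -> lie_poisson [set i; j] = linfct (br e`_i e`_j).
Proof.
move=> ij; rewrite ffunE (bigD1 i) //= (bigD1 j) //= eqxx.
rewrite big1 ?addr0 => [|k /andP[ik kj]]; last first.
  case: eqP => // /setP /(_ j); rewrite !inE eqxx orbT eq_sym => /esym/orP[] /eqP jj.
    by rewrite jj ltnn in ij.
  by rewrite jj eqxx in kj.
rewrite big1 ?addr0 // => k ki; apply: big1 => l kl; case: eqP => // E.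
have /setP /(_ k) := E; rewrite !inE eqxx /= (negPf ki) => /eqP kj.
have /setP /(_ i) := E; rewrite !inE eqxx /= eq_sym (negPf ki) => /esym /eqP il.
by move: kl; rewrite kj -il ltnNge (ltnW ij).
Qed.

Lemma lie_poissonP x y :
  poisson_bracket lie_poisson (linfct x) (linfct y) = linfct (br x y).
Proof.
have brDl u v w : br (u + v) w = br u w + br v w.
  by have := lie_linear_l br_lie 1 u v w; rewrite !scale1r.
have brDr u v w : br w (u + v) = br w u + br w v.
  by have := lie_linear_r br_lie 1 u v w; rewrite !scale1r.
have brN u v : br v u = - br u v.
  have := lie_alt br_lie (u + v); rewrite brDl !brDr !(lie_alt br_lie).
  by rewrite add0r addr0 addrC => /eqP; rewrite addr_eq0 => /eqP.
have linfctZ a u : linfct (a *: u) = a *: linfct u.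
  by rewrite scaler_sumr; apply: eq_bigr => i _; rewrite linearZ /= scalerA.
pose F (i j : 'I_n) : {mpoly K[n]} :=
  (coord e i x * coord e j y) *: linfct (br e`_i e`_j).
transitivity (\sum_(i < n) \sum_(j < n) F i j); last first.
  rewrite [x in RHS]sum_coord br_suml linfct_sum; apply: eq_bigr => i _.
  rewrite [y in RHS]sum_coord br_sumr linfct_sum scaler_sumr.
  by apply: eq_bigr => j _; rewrite scalerA.
have -> : \sum_(i < n) \sum_(j < n) F i j =
          \sum_(i < n) \sum_(j < n | (i < j)%N) (F i j + F j i).
  under [RHS]eq_bigr do rewrite big_split.
  rewrite big_split /= [X in _ + X](exchange_big_dep xpredT) //= -big_split /=.
  apply: eq_bigr => i _; rewrite (bigID (fun j : 'I_n => (i < j)%N)) /=.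
  congr (_ + _); rewrite (bigD1 i) ?ltnn //= {1}/F (lie_alt br_lie).
  rewrite -(scale0r (0 : g)) linfctZ scale0r scaler0 add0r; apply: eq_bigl => j.
  by rewrite -leqNgt ltn_neqAle andbC.
apply: eq_bigr => i _; apply: eq_bigr => j ij; rewrite lie_poisson_coef //.
rewrite !mderiv_linfct -!mpolyCM -mpolyCB mulrC mul_mpolyC /F.
by rewrite (brN e`_i e`_j) -scaleN1r linfctZ scalerA mulrN1 -scalerDl.
Qed.

End LiePoisson.

(* Main.v *)
From HB Require Import structures.
Require Import Defs.
From mathcomp Require Import ring.

Set Implicit Arguments.
Unset Strict Implicit.
Unset Printing Implicit Defensive.

Import GRing.Theory.
Local Open Scope ring_scope.

(** A multivector field of degree p on the dual of g whose coefficients are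
    quadratic is the same thing as a p-cochain on g with values in S^2(g): its
    value on x_1, .., x_p is the result of contracting the field with the
    differentials of the linear functions x_1, .., x_p. Under this
    correspondence, bracketing with the Lie-Poisson bivector [pi1] is, up to
    sign, the Chevalley-Eilenberg differential. The differential is determined
    by its values on basis vectors, and there it can be compared with the
    Schouten bracket coefficient by coefficient. In the degrees that matter
    this gives, for a function f, a vector field X and a bivector eta,
      hamiltonian pi1 f = d f,    schouten X pi1 = - d X,
      schouten eta pi1 = d eta
    ([hamiltonian_coef] with [sym_act_basis], [ce_diff_cochain1_basis] and
    [ce_diff_bivector_basis]). Hence a bivector compatible with [pi1] is a
    2-cocycle ([cocycle_bivector]), so that eta = d t for some 1-cochain t, and
    X = - t satisfies schouten X pi1 = eta. A vector field killed by
    schouten _ pi1 is a 1-cocycle ([cocycle_vector]), so it is d f for a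
    quadratic polynomial f, which says that it is hamiltonian. That X is
    determined up to such fields is additivity of the bracket. *)

(** * Wedge products in coordinates *)

Section Coordinates.

Variables (K : fieldType) (n : nat).
Implicit Types (i j k l : 'I_n) (A B C : {set 'I_n}) (f h : {mpoly K[n]}).
Implicit Types (P Q V X : multivector K n).

Lemma sgn_card A B :
  sgn K A B = (-1) ^+ (\sum_(i in A) \sum_(j in B) (j < i)%N).
Proof.
congr (_ ^+ _); rewrite -sum1_card pair_big /= big_mkcond [RHS]big_mkcond /=.
by apply: eq_bigr => u _; rewrite !inE andbA; case: (_ && _) (_ < _)%N => [] [].
Qed.

Lemma sum_subset1 (F : {set 'I_n} -> {mpoly K[n]}) C :
  (forall A, #|A| != 1%N -> F A = 0) ->
  \sum_(A : {set 'I_n} | A \subset C) F A = \sum_(i in C) F [set i].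
Proof.
move=> F0; rewrite -(big_imset F (in2W set1_inj)) /= big_mkcond [RHS]big_mkcond.
apply: eq_bigr => A _; case: (eqVneq #|A| 1%N) => [/eqP/cards1P[i ->]|/F0 ->].
  by rewrite (mem_imset _ _ set1_inj) sub1set.
by rewrite !if_same.
Qed.

(** Wedging with a vector field removes one index at a time. This and the next
    formula turn a bracket with a bivector into an explicit sum of a few terms. *)
Lemma wedge_vl V Q C : vector_field V ->
  wedge V Q C = \sum_(i in C) sgn K [set i] (C :\ i) * V [set i] * Q (C :\ i).
Proof.
by move=> vV; rewrite ffunE sum_subset1 // => A /vV ->; rewrite mulr0 mul0r.
Qed.

Lemma wedge_vr V Q C : vector_field V ->
  wedge Q V C = \sum_(i in C) sgn K (C :\ i) [set i] * Q (C :\ i) * V [set i].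
Proof.
move=> vV; pose F A := sgn K (C :\: A) A * Q (C :\: A) * V A.
rewrite -[RHS](sum_subset1 (F := F)) => [|A /vV /=]; last first.
  by rewrite /F => ->; rewrite mulr0.
rewrite ffunE (reindex_onto (setD C) (setD C)) => [|A AC]; last first.
  by rewrite setDDr setDv set0U; apply/setIidPr.
apply: eq_big => A => [|/andP[_ /eqP E]]; last by rewrite /F E.
by rewrite subsetDl /= setDDr setDv set0U; apply/eqP/setIidPr.
Qed.

(** * Coefficients of bivectors *)

(** The coefficient of [d_i /\ d_j] in a bivector, as an antisymmetric function
    of a pair of indices in any order. *)
Definition bcoef P i j : {mpoly K[n]} := poisson_bracket P 'X_i 'X_j.

Lemma mderiv_var i j : ('X_i : {mpoly K[n]})^`M(j) = (i == j)%:R.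
Proof.
rewrite mderivX mnm1E; case: eqP => [<-|_]; last by rewrite scale0r.
rewrite scale1r -[1%:R]mpolyX0; congr 'X_[_].
by apply/mnmP => k; rewrite mnmBE subnn mnm0E.
Qed.

Lemma poisson_bracketN P f h : poisson_bracket P f h = - poisson_bracket P h f.
Proof.
rewrite -sumrN; apply: eq_bigr => i _; rewrite -sumrN; apply: eq_bigr => j _.
by ring.
Qed.

Lemma poisson_bracket_alt P f : poisson_bracket P f f = 0.
Proof.
by apply: big1 => i _; apply: big1 => j _; ring.
Qed.

Lemma bcoefN P i j : bcoef P i j = - bcoef P j i.
Proof. exact: poisson_bracketN. Qed.

Lemma bcoefii P i : bcoef P i i = 0.
Proof. exact: poisson_bracket_alt. Qed.

Lemma bcoef_lt P i j : (i < j)%N -> bcoef P i j = P [set i; j].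
Proof.
move=> ij; rewrite /bcoef /poisson_bracket (bigD1 i) //= (bigD1 j) //=.
have nij : (i == j) = false by rewrite -val_eqE ltn_eqF.
rewrite !mderiv_var !eqxx [j == i]eq_sym nij mulr0 subr0 !mulr1.
rewrite !big1 ?addr0 // => [k ki|k /andP[ik kj]]; last first.
  rewrite !mderiv_var [j == k]eq_sym (negPf kj).
  by rewrite !mulr0 subrr mulr0.
apply: big1 => l kl; rewrite !mderiv_var [i == k]eq_sym (negPf ki) mul0r sub0r.
case: eqP => [il|]; last by rewrite mul0r oppr0 mulr0.
case: eqP => [jk|]; last by rewrite mulr0 oppr0 mulr0.
by move: kl; rewrite -il -jk ltnNge ltnW.
Qed.

Lemma rodd1 P l i : rodd l P [set i] = bcoef P i l.
Proof.
rewrite ffunE inE sgn_card !big_set1; case: ltngtP => [li|il|/val_inj <-].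
- by rewrite -val_eqE ltn_eqF // expr1 mulN1r bcoefN bcoef_lt.
- by rewrite -val_eqE gtn_eqF // expr0 mul1r bcoef_lt // setUC.
- by rewrite eqxx bcoefii.
Qed.

Lemma lodd1 P l i : lodd l P [set i] = bcoef P l i.
Proof.
rewrite ffunE inE sgn_card !big_set1; case: ltngtP => [il|li|/val_inj <-].
- by rewrite -val_eqE gtn_eqF // expr1 mulN1r bcoefN bcoef_lt // setUC.
- by rewrite -val_eqE ltn_eqF // expr0 mul1r bcoef_lt.
- by rewrite eqxx bcoefii.
Qed.

Lemma rodd0 V l : rodd l V set0 = V [set l].
Proof. by rewrite ffunE inE setU0 sgn_card big_set0 mul1r. Qed.

(** * Degrees *)

Lemma has_degree_rodd p P l : has_degree p.+1 P -> has_degree p (rodd l P).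
Proof.
move=> dP A Ap; rewrite ffunE; case: ifPn => // lA.
by rewrite dP ?mulr0 // cardsU1 lA.
Qed.

Lemma has_degree_lodd p P l : has_degree p.+1 P -> has_degree p (lodd l P).
Proof.
move=> dP A Ap; rewrite ffunE; case: ifPn => // lA.
by rewrite dP ?mulr0 // cardsU1 lA.
Qed.

Lemma has_degree_pderiv p P l : has_degree p P -> has_degree p (pderiv l P).
Proof. by move=> dP A Ap; rewrite ffunE dP // mderiv0. Qed.

Lemma has_degree_wedge p q P Q :
  has_degree p P -> has_degree q Q -> has_degree (p + q) (wedge P Q).
Proof.
move=> dP dQ C Cpq; rewrite ffunE big1 // => A AC.
have [Ap|/dP ->] := eqVneq #|A| p; last by rewrite mulr0 mul0r.
rewrite dQ ?mulr0 //; apply: contraNneq Cpq => /eqP.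
by rewrite -(cardsID A C) (setIidPr AC) Ap => /eqP ->.
Qed.

(** * The Schouten bracket in low degrees *)

Lemma schouten_coef P Q C : schouten P Q C = \sum_(l < n)
  (wedge (rodd l P) (pderiv l Q) C - wedge (pderiv l P) (lodd l Q) C).
Proof. by rewrite sum_ffunE; apply: eq_bigr => l _; rewrite !ffunE. Qed.

Lemma has_degree_schouten p q P Q :
  has_degree p.+1 P -> has_degree q.+1 Q ->
  has_degree (p + q).+1 (schouten P Q).
Proof.
move=> dP dQ C Cpq; rewrite schouten_coef big1 // => l _.
have d1 := has_degree_wedge (has_degree_rodd l dP) (has_degree_pderiv l dQ).
have d2 := has_degree_wedge (has_degree_pderiv l dP) (has_degree_lodd l dQ).
by rewrite d1 ?addnS // d2 ?addSn ?subrr.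
Qed.

Lemma schoutenDl P Q V : schouten (P + Q) V = schouten P V + schouten Q V.
Proof.
apply/ffunP => C; rewrite [RHS]ffunE !schouten_coef -big_split /=.
apply: eq_bigr => l _; rewrite addrACA -opprD !ffunE -!big_split /=.
congr (_ - _); apply: eq_bigr => A _; rewrite !ffunE ?mderivD //; last by ring.
by case: ifP => _; ring.
Qed.

Lemma wedge_pair V Q i j : vector_field V -> (i < j)%N ->
  wedge V Q [set i; j] = V [set i] * Q [set j] - V [set j] * Q [set i].
Proof.
move=> vV ij; have nij : i != j by rewrite -val_eqE ltn_eqF.
rewrite wedge_vl // big_setU1 ?inE //= big_set1 !sgn_card.
have -> : [set i; j] :\ i = [set j].
  apply/setP => k; rewrite !inE; case: (eqVneq k i) => //= ->.
  by rewrite (negPf nij).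
have -> : [set i; j] :\ j = [set i].
  apply/setP => k; rewrite !inE; case: (eqVneq k j) => //= [->|_].
    by rewrite eq_sym (negPf nij).
  by rewrite orbF.
rewrite !big_set1 ij ltnNge ltnW //=; ring.
Qed.

(** The sign of the middle term is absorbed by writing the coefficients of [Q]
    cyclically, and a vector field commutes with a bivector, so both orders have
    the same value. *)
Lemma wedge_triple V Q i j k : vector_field V -> (i < j < k)%N ->
  wedge V Q [set i; j; k] =
    V [set i] * bcoef Q j k + V [set j] * bcoef Q k i + V [set k] * bcoef Q i j
  /\ wedge Q V [set i; j; k] =
    V [set i] * bcoef Q j k + V [set j] * bcoef Q k i + V [set k] * bcoef Q i j.
Proof.
move=> vV /andP[ij jk]; have ik := ltn_trans ij jk.
rewrite wedge_vl // wedge_vr // [bcoef Q k i]bcoefN !bcoef_lt //.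
have [nij njk nik] : [/\ i != j, j != k & i != k].
  by split; rewrite -val_eqE ltn_eqF.
rewrite -setUA !big_setU1 ?inE ?negb_or ?nij ?nik //= !big_set1 !sgn_card.
have -> : (i |: [set j; k]) :\ i = [set j; k].
  by rewrite setU1K // !inE negb_or nij.
have -> : (i |: [set j; k]) :\ j = [set i; k].
  by rewrite setUCA setU1K // !inE negb_or eq_sym nij.
have -> : (i |: [set j; k]) :\ k = [set i; j].
  by rewrite setUA setUC setU1K // !inE negb_or ![k == _]eq_sym nik.
have gtF a b : (a < b)%N -> (b < a)%N = false by move=> ab; rewrite ltnNge ltnW.
have sum2 (F : 'I_n -> nat) a b : a != b ->
    (\sum_(c in [set a; b]) F c = F a + F b)%N.
  by move=> nab; rewrite big_setU1 ?inE //= big_set1.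
rewrite !big_set1 !sum2 // !big_set1 ij jk ik.
rewrite ?(gtF _ _ ij) ?(gtF _ _ ik) ?(gtF _ _ jk).
by split; ring.
Qed.

Lemma wedge_0l V Q C : has_degree 0 V -> wedge V Q C = V set0 * Q C.
Proof.
move=> dV; rewrite ffunE (bigD1 set0) ?sub0set //= setD0 sgn_card big_set0.
rewrite mul1r big1 ?addr0 // => A /andP[_ A0].
by rewrite dV ?cards_eq0 // mulr0 mul0r.
Qed.

Lemma wedge_0r V Q C : has_degree 0 V -> wedge Q V C = Q C * V set0.
Proof.
move=> dV; rewrite ffunE (bigD1 C) //= setDv sgn_card.
rewrite (eq_bigr (fun=> 0%N)) => [|i _]; last by rewrite big_set0.
rewrite sum_nat_const muln0 mul1r big1 ?addr0 // => A /andP[AC nAC].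
rewrite [V _]dV ?mulr0 // cards_eq0 setD_eq0.
by apply: contra nAC => CA; rewrite eqEsubset AC.
Qed.

(** The signs in [bcoef] are constant, so they commute with derivatives. *)
Lemma bcoef_pderiv P l i j : bcoef (pderiv l P) i j = (bcoef P i j)^`M(l).
Proof.
have lt_case (a b : 'I_n) : (a < b)%N ->
    bcoef (pderiv l P) a b = (bcoef P a b)^`M(l).
  by move=> ab; rewrite !bcoef_lt // ffunE.
case: (ltngtP i j) => [/lt_case //|ji|/val_inj ->]; last first.
  by rewrite !bcoefii mderiv0.
by rewrite bcoefN lt_case // -mderivN -bcoefN.
Qed.

Lemma has_degree_mvfun f : has_degree 0 (mvfun f).
Proof. by move=> A A0; rewrite ffunE -cards_eq0 (negPf A0). Qed.

Lemma lodd_mvfun l f : lodd l (mvfun f) = 0.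
Proof.
apply/ffunP => A; rewrite !ffunE; case: ifPn => // lA.
by rewrite -cards_eq0 cardsU1 lA mulr0.
Qed.

Lemma hamiltonian_wedge P f C :
  hamiltonian P f C = \sum_l rodd l P C * f^`M(l).
Proof.
rewrite schouten_coef; apply: eq_bigr => l _.
rewrite wedge_0r; last by apply: has_degree_pderiv; apply: has_degree_mvfun.
rewrite lodd_mvfun !ffunE eqxx big1 ?subr0 // => A _.
by rewrite !ffunE mulr0.
Qed.

Lemma hamiltonian_coef P f i :
  hamiltonian P f [set i] = \sum_l bcoef P i l * f^`M(l).
Proof.
by rewrite hamiltonian_wedge; apply: eq_bigr => l _; rewrite rodd1.
Qed.

Lemma vector_field_hamiltonian P f :
  bivector P -> vector_field (hamiltonian P f).
Proof.
move=> bP C C1; rewrite hamiltonian_wedge big1 // => l _.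
by rewrite (has_degree_rodd l bP) // mul0r.
Qed.

(** The coefficient of [d_i /\ d_j] in [schouten X P], for a vector field [X]
    and a bivector [P], as an alternating function of two indices in any
    order. *)
Definition schouten2 X P i j : {mpoly K[n]} :=
  \sum_l (X [set l] * (bcoef P i j)^`M(l)
          - (X [set i])^`M(l) * bcoef P l j + (X [set j])^`M(l) * bcoef P l i).

Lemma schouten2N X P i j : schouten2 (- X) P i j = - schouten2 X P i j.
Proof.
by rewrite -sumrN; apply: eq_bigr => l _; rewrite !ffunE !mderivN; ring.
Qed.

Lemma schouten_vector_bivector X P i j : vector_field X -> (i < j)%N ->
  schouten X P [set i; j] = schouten2 X P i j.
Proof.
move=> vX ij; rewrite schouten_coef; apply: eq_bigr => l _.
rewrite wedge_0l; last exact: has_degree_rodd.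
rewrite wedge_pair //; last exact: has_degree_pderiv.
rewrite !lodd1 rodd0 -bcoef_pderiv (bcoef_lt _ ij) !ffunE; ring.
Qed.

(** The coefficient of [d_i /\ d_j /\ d_k] in the Schouten bracket of two
    bivectors, as an alternating function of three indices in any order: the
    polarized Jacobiator, a sum over the cyclic permutations of [i, j, k]. *)
Definition schouten3 P Q i j k : {mpoly K[n]} := \sum_l
    ((bcoef P i l * (bcoef Q j k)^`M(l) + bcoef Q i l * (bcoef P j k)^`M(l))
   + (bcoef P j l * (bcoef Q k i)^`M(l) + bcoef Q j l * (bcoef P k i)^`M(l))
   + (bcoef P k l * (bcoef Q i j)^`M(l) + bcoef Q k l * (bcoef P i j)^`M(l))).

Lemma schouten_bivectors P Q i j k : bivector P -> bivector Q ->
  (i < j < k)%N ->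
  schouten P Q [set i; j; k] = schouten3 P Q i j k.
Proof.
move=> bP bQ ijk; rewrite schouten_coef; apply: eq_bigr => l _.
have [-> _] := wedge_triple (pderiv l Q) (has_degree_rodd l bP) ijk.
have [_ ->] := wedge_triple (pderiv l P) (has_degree_lodd l bQ) ijk.
rewrite !rodd1 !lodd1 !bcoef_pderiv.
rewrite (bcoefN Q l i) (bcoefN Q l j) (bcoefN Q l k).
move: (bcoef P) (bcoef Q) => p q; ring.
Qed.

(** The bracket only records increasing indices; antisymmetry gives the others.
    The unordered form is what can be compared with a cochain evaluated on
    arbitrary basis vectors. *)
Lemma schouten_vector_bivector_eq0 X P : vector_field X ->
  schouten X P = 0 -> forall i j, schouten2 X P i j = 0.
Proof.
move=> vX XP0; have lt_case (i j : 'I_n) : (i < j)%N -> schouten2 X P i j = 0.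
  by move=> ij; rewrite -schouten_vector_bivector // XP0 ffunE.
move=> i j; case: (ltngtP i j) => [/lt_case //|/lt_case ji|/val_inj ->].
  rewrite -[RHS]oppr0 -ji /schouten2 -sumrN; apply: eq_bigr => l _.
  by rewrite (bcoefN P i j) mderivN; move: (bcoef P) => p; ring.
apply: big1 => l _; rewrite bcoefii mderiv0; ring.
Qed.

Lemma bivector_eq P Q : bivector P -> bivector Q ->
  (forall i j, (i < j)%N -> P [set i; j] = Q [set i; j]) -> P = Q.
Proof.
move=> bP bQ PQ; apply/ffunP => A.
have [A2|A2] := eqVneq #|A| 2%N; last by rewrite bP ?bQ.
have /cards2P[i [j [nij ->]]] : #|A| == 2%N by rewrite A2.
by case: (ltngtP i j) nij => [/PQ //|/PQ|/val_inj ->]; rewrite ?eqxx // setUC.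
Qed.

Lemma vector_field_eq P Q : vector_field P -> vector_field Q ->
  (forall i, P [set i] = Q [set i]) -> P = Q.
Proof.
move=> vP vQ PQ; apply/ffunP => A.
have [/eqP/cards1P[i ->]|A1] := eqVneq #|A| 1%N; first exact: PQ.
by rewrite vP ?vQ.
Qed.

(** As for [schouten2]: cyclic invariance and antisymmetry of [schouten3] reduce
    every triple of indices to an increasing one, or to one with a repetition,
    where all terms cancel. *)
Lemma schouten_bivectors_eq0 P Q : bivector P -> bivector Q ->
  schouten P Q = 0 -> forall i j k, schouten3 P Q i j k = 0.
Proof.
move=> bP bQ PQ0 i j k; pose J := schouten3 P Q; rewrite -/(J i j k).
have Jlt (a b c : 'I_n) : (a < b)%N -> (b < c)%N -> J a b c = 0.
  by move=> ab bc; rewrite /J -schouten_bivectors ?ab // PQ0 ffunE.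
have JC a b c : J a b c = J b c a.
  by apply: eq_bigr => l _; move: (bcoef P) (bcoef Q) => p q; ring.
have JN a b c : J a b c = - J b a c.
  rewrite /J /schouten3 -sumrN; apply: eq_bigr => l _.
  rewrite (bcoefN P a b) (bcoefN Q a b) (bcoefN P b c) (bcoefN Q b c).
  rewrite (bcoefN P c a) (bcoefN Q c a) !mderivN.
  by move: (bcoef P) (bcoef Q) => p q; ring.
have J0 a c : J a a c = 0.
  rewrite /J /schouten3 big1 // => l _; rewrite !bcoefii.
  rewrite (bcoefN P c a) (bcoefN Q c a) !mderivN mderiv0.
  by move: (bcoef P) (bcoef Q) => p q; ring.
have Jlt2 (a b c : 'I_n) : (a < b)%N -> J a b c = 0.
  move=> ab; case: (ltngtP b c) => [bc|cb|/val_inj <-]; first exact: Jlt.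
    2: by rewrite JC J0.
  case: (ltngtP a c) => [ac|ca|/val_inj <-].
  - by rewrite -JC JN Jlt ?oppr0.
  - by rewrite -JC Jlt.
  - by rewrite -JC J0.
case: (ltngtP i j) => [/Jlt2->//|ji|/val_inj ->]; last exact: J0.
by rewrite JN Jlt2 ?oppr0.
Qed.

End Coordinates.

(** * The Chevalley-Eilenberg differential in low degrees *)

Section LowDegreeDifferentials.

Variables (K : fieldType) (g : vectType K) (M : lmodType K).
Variables (br : g -> g -> g) (act : g -> M -> M).
Implicit Types (w : seq g -> M) (x y z : g).

Lemma ce_diff1 w x : ce_diff br act w [:: x] = act x (w [::]).
Proof. by rewrite /ce_diff !big_ord1 big_ord0 scale1r addr0. Qed.

Lemma ce_diff2 w x y : ce_diff br act w [:: x; y] =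
  act x (w [:: y]) - act y (w [:: x]) - w [:: br x y].
Proof.
rewrite /ce_diff /= !big_ord_recl !big_ord0 /=.
by rewrite /bump /= !(addr0, add0r, scale1r, scaleN1r, expr1).
Qed.

Lemma ce_diff3 w x y z : ce_diff br act w [:: x; y; z] =
  act x (w [:: y; z]) - act y (w [:: x; z]) + act z (w [:: x; y])
  - w [:: br x y; z] + w [:: br x z; y] - w [:: br y z; x].
Proof.
rewrite /ce_diff /= !big_ord_recl !big_ord0 /=.
rewrite /bump /= /delete /= !(addr0, add0r).
rewrite !(scale1r, scaleN1r, expr0, expr1, exprS, mulN1r, opprK, mulr1) !addrA.
by [].
Qed.

Lemma cochain1_linear w : cochain 1 w -> linear (fun x => w [:: x]).
Proof.
by move=> cw a x y; apply: (cochain_linear cw (s1 := [::]) (s2 := [::])).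
Qed.

Lemma linear_funD (U : lmodType K) (F G : U -> M) :
  linear F -> linear G -> linear (fun u => F u + G u).
Proof. by move=> lF lG a u v; rewrite lF lG scalerDr addrACA. Qed.

Lemma linear_funN (U : lmodType K) (F : U -> M) :
  linear F -> linear (fun u => - F u).
Proof. by move=> lF a u v; rewrite lF opprD scalerN. Qed.

Lemma eq_linear (U : lmodType K) (F G : U -> M) :
  F =1 G -> linear G -> linear F.
Proof. by move=> FG lG a u v; rewrite !FG; apply: lG. Qed.

Hypotheses (br_lie : lie_bracket br).
Hypotheses (act_l : forall p, linear (act^~ p)).
Hypotheses (act_r : forall x, linear (act x)).

(** Multilinearity of the differential makes the cocycle condition a matter of
    basis vectors only. *)
Lemma ce_diff2_linear w : cochain 1 w ->
  (forall y, linear (fun x => ce_diff br act w [:: x; y])) /\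
  (forall x, linear (fun y => ce_diff br act w [:: x; y])).
Proof.
move=> cw.
have br_w := (lie_linear_l br_lie, lie_linear_r br_lie, cochain1_linear cw).
split=> [y|x].
  apply: (eq_linear (fun x => ce_diff2 w x y)).
  by do ?[apply: linear_funD | apply: linear_funN] => a u v;
    rewrite ?br_w ?act_l ?act_r.
apply: (eq_linear (fun y => ce_diff2 w x y)).
by do ?[apply: linear_funD | apply: linear_funN] => a u v;
    rewrite ?br_w ?act_l ?act_r.
Qed.

Lemma ce_diff3_linear w : cochain 2 w ->
  [/\ forall y z, linear (fun x => ce_diff br act w [:: x; y; z]),
      forall x z, linear (fun y => ce_diff br act w [:: x; y; z]) &
      forall x y, linear (fun z => ce_diff br act w [:: x; y; z])].
Proof.
move=> cw.
have w1 y a u v : w [:: a *: u + v; y] = a *: w [:: u; y] + w [:: v; y].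
  exact: (cochain_linear cw (s1 := [::]) (s2 := [:: y])).
have w2 x a u v : w [:: x; a *: u + v] = a *: w [:: x; u] + w [:: x; v].
  exact: (cochain_linear cw (s1 := [:: x]) (s2 := [::])).
have br_w := (lie_linear_l br_lie, lie_linear_r br_lie, w1, w2).
split=> [y z|x z|x y].
- apply: (eq_linear (fun x => ce_diff3 w x y z)).
  by do ?[apply: linear_funD | apply: linear_funN] => a u v;
    rewrite ?br_w ?act_l ?act_r.
- apply: (eq_linear (fun y => ce_diff3 w x y z)).
  by do ?[apply: linear_funD | apply: linear_funN] => a u v;
    rewrite ?br_w ?act_l ?act_r.
apply: (eq_linear (fun z => ce_diff3 w x y z)).
by do ?[apply: linear_funD | apply: linear_funN] => a u v;
    rewrite ?br_w ?act_l ?act_r.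
Qed.

End LowDegreeDifferentials.

(** * The Lie-Poisson bivector and quadratic cochains *)

Section LiePoissonCochains.

Variables (K : fieldType) (n : nat) (g : vectType K) (br : g -> g -> g).
Variable e : n.-tuple g.
Hypotheses (br_lie : lie_bracket br) (e_basis : basis_of fullv e).
Implicit Types (i j k l : 'I_n) (x y z : g) (p q : {mpoly K[n]}).

Let pi1 := lie_poisson br e.
Let act := sym2_act br e.

Lemma linear_coord (M : lmodType K) (F : g -> M) x :
  linear F -> F x = \sum_i coord e i x *: F e`_i.
Proof.
move=> lF; pose LF := GRing.isLinear.Build K g M *:%R F lF.
pose F' : {linear g -> M} := HB.pack F LF.
rewrite -[LHS]/(F' x) [x in LHS](coord_basis e_basis (memvf x)) linear_sum.
by apply: eq_bigr => i _; rewrite linearZ.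
Qed.

Lemma linear_basis_eq0 (M : lmodType K) (F : g -> M) :
  linear F -> (forall i, F e`_i = 0) -> forall x, F x = 0.
Proof.
move=> lF F0 x; rewrite (linear_coord x lF) big1 // => i _.
by rewrite F0 scaler0.
Qed.

Lemma linfct_linear : linear (linfct e).
Proof.
move=> a x y; rewrite scaler_sumr -big_split; apply: eq_bigr => i _.
by rewrite linearP scalerDl scalerA.
Qed.

Lemma linfct_basis i : linfct e e`_i = 'X_i.
Proof.
rewrite /linfct (bigD1 i) //= coord_free ?(basis_free e_basis) // eqxx scale1r.
rewrite big1 ?addr0 // => j ji.
by rewrite coord_free ?(basis_free e_basis) // eq_sym (negPf ji) scale0r.
Qed.

Lemma mderiv_linfct x l : (linfct e x)^`M(l) = (coord e l x)%:MP.
Proof.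
rewrite raddf_sum (bigD1 l) //= mderivZ mderiv_var eqxx big1 ?addr0 => [|j jl].
  by rewrite -mul_mpolyC mulr1.
by rewrite mderivZ mderiv_var (negPf jl) scaler0.
Qed.

(** The coordinates of [x] are the partial derivatives of [linfct e x]. In this
    form the terms w([x, y], ..) of the differential become the derivatives of
    the coefficients of [pi1] that occur in the Schouten bracket. *)
Lemma linear_mderiv_linfct (F : g -> {mpoly K[n]}) x :
  linear F -> F x = \sum_l (linfct e x)^`M(l) * F e`_l.
Proof.
move=> /linear_coord->; apply: eq_bigr => l _.
by rewrite mderiv_linfct mul_mpolyC.
Qed.

Lemma bcoef_lie_poisson i j : bcoef pi1 i j = linfct e (br e`_i e`_j).
Proof. by rewrite -(lie_poissonP br_lie e_basis) !linfct_basis. Qed.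

(** The adjoint action of a basis vector is the hamiltonian derivation of the
    corresponding coordinate; with [hamiltonian_coef] this identifies
    f |-> hamiltonian pi1 f with the differential of 0-cochains. *)
Lemma sym_act_basis i p : sym_act br e e`_i p = \sum_l bcoef pi1 i l * p^`M(l).
Proof. by apply: eq_bigr => l _; rewrite bcoef_lie_poisson. Qed.

Lemma bivector_lie_poisson : bivector pi1.
Proof.
move=> A A2; rewrite ffunE big1 // => i _; rewrite big1 // => j ij.
have nij : i != j by rewrite -val_eqE ltn_eqF.
by case: eqP => // E; rewrite E cards2 nij in A2.
Qed.

Lemma sym_act_linear x : linear (sym_act br e x).
Proof.
move=> a p q; rewrite scaler_sumr -big_split; apply: eq_bigr => i _.
by rewrite mderivD mderivZ mulrDr scalerAr.
Qed.

Lemma sym2_act_linear_r x : linear (act x).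
Proof. by move=> a p q; apply: val_inj; apply: sym_act_linear. Qed.

Lemma sym2_act_linear_l (p : sym2 K n) : linear (act^~ p).
Proof.
move=> a x y; apply: val_inj => /=.
rewrite /sym_act scaler_sumr -big_split; apply: eq_bigr => i _.
by rewrite (lie_linear_l br_lie) linfct_linear mulrDl scalerAl.
Qed.

Lemma poisson_bracket_linear_l P q : linear (@poisson_bracket K n P ^~ q).
Proof.
move=> a p1 p2; rewrite scaler_sumr -big_split; apply: eq_bigr => i _.
rewrite scaler_sumr -big_split; apply: eq_bigr => j _ /=.
rewrite !mderivD !mderivZ -!mul_mpolyC; ring.
Qed.

Lemma poisson_bracket_linear_r P p : linear (@poisson_bracket K n P p).
Proof.
move=> a q1 q2; rewrite poisson_bracketN poisson_bracket_linear_l.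
by rewrite opprD -scalerN -!poisson_bracketN.
Qed.

(** In [schouten X pi1], the derivatives of [X] contracted with [pi1] give the
    action terms of the differential and the derivatives of [pi1] contracted
    with [X] give the bracket term, all with the opposite sign. *)
Lemma ce_diff_cochain1_basis (X : multivector K n) (t : seq g -> sym2 K n) i j :
  cochain 1 t -> (forall l, t [:: e`_l] = X [set l] :> {mpoly K[n]}) ->
  ce_diff br act t [:: e`_i; e`_j] = - schouten2 X pi1 i j :> {mpoly K[n]}.
Proof.
move=> ct tX; pose F x := t [:: x] : {mpoly K[n]}.
have lF : linear F by move=> a x y; rewrite /F (cochain1_linear ct).
rewrite ce_diff2 !raddfB /= !tX !sym_act_basis -/(F _).
rewrite (linear_mderiv_linfct _ lF) -bcoef_lie_poisson -!sumrN -!big_split.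
apply: eq_bigr => l _; rewrite /F tX (bcoefN _ l j) (bcoefN _ l i) /=.
by move: (bcoef pi1) => p; ring.
Qed.

Lemma poisson_bracket_br (eta : multivector K n) i j k :
  poisson_bracket eta (linfct e (br e`_i e`_j)) 'X_k =
  \sum_l (bcoef pi1 i j)^`M(l) * bcoef eta l k.
Proof.
pose F x := poisson_bracket eta (linfct e x) 'X_k.
have lF : linear F.
  by move=> a x y; rewrite /F linfct_linear poisson_bracket_linear_l.
rewrite -/(F _) (linear_mderiv_linfct _ lF) bcoef_lie_poisson.
by apply: eq_bigr => l _; rewrite /F linfct_basis.
Qed.

Section Bivector.

Variables (eta : multivector K n) (eta_quad : quadratic eta).

Fact bivector_form_homog x y :
  poisson_bracket eta (linfct e x) (linfct e y) \is 2.-homog.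
Proof.
have d0 z i : (linfct e z)^`M(i) \is 0.-homog.
  exact: mderiv_homog (linfct_homog e z).
apply: rpred_sum => i _; apply: rpred_sum => j _.
apply: (@dhomogM _ _ _ 2%N _ 0%N); first exact: eta_quad.
by apply: rpredB; apply: (@dhomogM _ _ _ 0%N _ 0%N).
Qed.

(** Only the first two entries are read, since the values of a 2-cochain on lists
    of another length carry no information. *)
Definition bivector_cochain (s : seq g) : sym2 K n :=
  DHomog (bivector_form_homog s`_0 s`_1).

Lemma cochain_bivector : cochain 2 bivector_cochain.
Proof.
split=> [s1 s2 a x y|s1 s2 s3 x].
  case: s1 s2 => [|u [|? ?]] [|v [|? ?]] // _; apply: val_inj => /=.
    by rewrite linfct_linear poisson_bracket_linear_l.
  by rewrite linfct_linear poisson_bracket_linear_r.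
case: s1 s2 s3 => [|? ?] [|? ?] [|? ?] // _; apply: val_inj => /=.
exact: poisson_bracket_alt.
Qed.

Lemma ce_diff_bivector_basis i j k :
  ce_diff br act bivector_cochain [:: e`_i; e`_j; e`_k] =
  schouten3 eta pi1 i j k :> {mpoly K[n]}.
Proof.
rewrite ce_diff3 !(raddfB, raddfD) /= !linfct_basis.
rewrite !sym_act_basis !poisson_bracket_br -!/(bcoef _ _ _).
rewrite -!sumrN -!big_split; apply: eq_bigr => l _ /=.
rewrite (bcoefN _ l i) (bcoefN _ l j) (bcoefN _ l k).
rewrite (bcoefN eta k i) (bcoefN pi1 k i) !mderivN.
by move: (bcoef pi1) (bcoef eta) => p q; ring.
Qed.

(** Compatibility kills the differential on all triples of basis vectors, hence
    everywhere by trilinearity. *)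
Lemma cocycle_bivector : bivector eta -> compatible eta pi1 ->
  cocycle br act 2 bivector_cochain.
Proof.
move=> eta2 eta_pi1; split=> [|[|x [|y [|z [|? ?]]]] // _].
  exact: cochain_bivector.
have [lx ly lz] := ce_diff3_linear br_lie sym2_act_linear_l sym2_act_linear_r
  cochain_bivector.
apply: (linear_basis_eq0 (lx y z)) => i.
apply: (linear_basis_eq0 (ly _ z)) => j.
apply: (linear_basis_eq0 (lz _ _)) => k; apply: val_inj.
rewrite [LHS]ce_diff_bivector_basis schouten_bivectors_eq0 //.
exact: bivector_lie_poisson.
Qed.

End Bivector.

Section VectorField.

Variables (X : multivector K n) (X_quad : quadratic X).

Fact vector_form_homog x : \sum_l X [set l] * (linfct e x)^`M(l) \is 2.-homog.
Proof.
apply: rpred_sum => l _; apply: (@dhomogM _ _ _ 2%N _ 0%N); first exact: X_quad.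
exact: mderiv_homog (linfct_homog e x).
Qed.

Definition vector_cochain (s : seq g) : sym2 K n :=
  DHomog (vector_form_homog s`_0).

Lemma vector_form_linear :
  linear (fun x => \sum_l X [set l] * (linfct e x)^`M(l)).
Proof.
move=> a x y /=; rewrite scaler_sumr -big_split; apply: eq_bigr => l _ /=.
by rewrite linfct_linear mderivD mderivZ mulrDr scalerAr.
Qed.

Lemma cochain_vector : cochain 1 vector_cochain.
Proof.
split=> // -[|? ?] [|? ?] a x y // _; apply: val_inj.
exact: vector_form_linear.
Qed.

Lemma vector_cochain_basis i :
  vector_cochain [:: e`_i] = X [set i] :> {mpoly K[n]}.
Proof.
rewrite /vector_cochain /= linfct_basis (bigD1 i) //= mderiv_var eqxx mulr1.
rewrite big1 ?addr0 // => l li.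
by rewrite mderiv_var eq_sym (negPf li) mulr0.
Qed.

Lemma cocycle_vector : vector_field X -> schouten X pi1 = 0 ->
  cocycle br act 1 vector_cochain.
Proof.
move=> vX X_pi1; split=> [|[|x [|y [|? ?]]] // _]; first exact: cochain_vector.
have [lx ly] := ce_diff2_linear br_lie sym2_act_linear_l sym2_act_linear_r
  cochain_vector.
apply: (linear_basis_eq0 (lx y)) => i; apply: (linear_basis_eq0 (ly _)) => j.
apply: val_inj.
rewrite [LHS](ce_diff_cochain1_basis i j cochain_vector vector_cochain_basis).
by rewrite schouten_vector_bivector_eq0 ?oppr0.
Qed.

End VectorField.

End LiePoissonCochains.

(** * Compatible quadratic Poisson bivectors *)

Theorem lemma2p1 (R : realType) (K : fieldType)
    (hK : K = R :> fieldType \/ K = R[i] :> fieldType)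
    (g : vectType K) (br : g -> g -> g) (hbr : lie_bracket br)
    (n : nat) (e : n.-tuple g) (he : basis_of fullv e)
    (H1 : cohomology_vanishes br (sym2_act br e) 1)
    (H2 : cohomology_vanishes br (sym2_act br e) 2) :
  let pi1 := lie_poisson br e in
  (forall eta : multivector K n,
     poisson eta -> quadratic eta -> compatible eta pi1 ->
     exists X : multivector K n,
       [/\ vector_field X, quadratic X & eta = schouten X pi1])
  /\
  ((forall eta X Y : multivector K n,
      poisson eta -> quadratic eta -> compatible eta pi1 ->
      vector_field X -> quadratic X -> eta = schouten X pi1 ->
      (vector_field Y /\ quadratic Y /\ eta = schouten Y pi1 <->
       exists Z : multivector K n,
         [/\ vector_field Z, quadratic Z, schouten Z pi1 = 0 & Y = X + Z]))
   /\
   (forall Z : multivector K n,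
      vector_field Z -> quadratic Z -> schouten Z pi1 = 0 ->
      exists2 f : {mpoly K[n]}, f \is 2.-homog & Z = hamiltonian pi1 f)).
Proof.
move=> pi1; have pi1_2 : bivector pi1 by apply: bivector_lie_poisson.
split; [|split].
- move=> eta [eta2 _] etaq eta_pi1.
  (* The cochain of eta is d t, and bracketing with pi1 is - d on vector fields,
     so the required field is minus the one with components t [:: e_i]. *)
  have [t ct dt] := H2 _ (cocycle_bivector hbr he etaq eta2 eta_pi1).
  pose X : multivector K n :=
    [ffun A : {set 'I_n} =>
       \sum_(i < n) if A == [set i] then t [:: e`_i] : {mpoly K[n]} else 0].
  have X1 (i : 'I_n) : t [:: e`_i] = X [set i] :> {mpoly K[n]}.
    rewrite ffunE (bigD1 i) //= eqxx big1 ?addr0 // => j ji.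
    by case: eqP => // /set1_inj ij; rewrite ij eqxx in ji.
  have vX : vector_field X.
    move=> A A1; rewrite ffunE big1 // => i _.
    by case: eqP => // E; rewrite E cards1 in A1.
  have qX : quadratic X.
    move=> A; rewrite ffunE; apply: rpred_sum => i _.
    by case: ifP => _; [exact: dhomog_is_dhomog | exact: rpred0].
  have vNX : vector_field (- X) by move=> A A1; rewrite ffunE vX ?oppr0.
  exists (- X); split=> // [A|]; first by rewrite ffunE rpredN.
  apply: bivector_eq => // [|i j ij].
    exact: has_degree_schouten vNX pi1_2.
  rewrite schouten_vector_bivector // schouten2N.
  rewrite -(ce_diff_cochain1_basis hbr he i j ct X1) -dt //=.
  by rewrite !linfct_basis // -/(bcoef _ _ _) bcoef_lt.
- move=> eta X Y _ _ _ vX qX etaX.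
  split=> [[vY [qY etaY]]|[Z [vZ qZ Z_pi1 ->]]].
    have YE : Y = X + (Y - X) by rewrite addrC subrK.
    exists (Y - X); split=> // [A A1|A|].
    + by rewrite !ffunE vX ?vY ?subr0.
    + by rewrite !ffunE rpredB.
    + by apply: (addrI eta); rewrite {1}etaX -schoutenDl -YE -etaY addr0.
  split=> [A A1|]; first by rewrite ffunE vX ?vZ ?addr0.
  split=> [A|]; first by rewrite ffunE rpredD.
  by rewrite schoutenDl Z_pi1 addr0.
- move=> Z vZ qZ Z_pi1.
  (* A 0-cochain is the single value t [::], a quadratic polynomial. *)
  have [t _ dt] := H1 _ (cocycle_vector hbr he qZ vZ Z_pi1).
  exists (t [::]); first exact: dhomog_is_dhomog.
  apply: vector_field_eq => // [|i]; first exact: vector_field_hamiltonian.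
  rewrite hamiltonian_coef -(sym_act_basis hbr he).
  by rewrite -(vector_cochain_basis he qZ) dt // ce_diff1.
Qed.
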